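(* Let $M$ be a matroid of rank $r$ and let $C_1,C_2$ be circuits of $M$ with $|C_1|=r+1$ and $|C_2|<r+1$. Then $\beta_{C_1}<\beta_{C_2}$.
   Context: Matroid bingo: let $M$ be a matroid on a finite set $E$ with $|E|=n$ and circuit set $\mathcal{C}$. The elements of $E$ are called out one at a time in a uniformly random order $\sigma(1),\sigma(2),\dots,\sigma(n)$ (a uniformly random permutation of $E$). A circuit $C$ wins in round $t$ if $C\subseteq\{\sigma(1),\dots,\sigma(t)\}$ and no circuit of $M$ is contained in $\{\sigma(1),\dots,\sigma(t-1)\}$; thus the winner is the first circuit to be completed (the circuit axioms guarantee that there is no tie). $\beta_C$ denotes the probability that $C$ wins (in some round). *)

(* Defs.v *)
From HB Require Import structures.
From mathcomp Require Import all_boot all_order all_algebra.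

Set Implicit Arguments.
Unset Strict Implicit.
Unset Printing Implicit Defensive.

Import GRing.Theory Num.Theory.

(* A matroid whose ground set is the whole finite type E, given by its
   family of independent sets. *)
Record matroid (E : finType) := Matroid {
  indep : {set {set E}};
  indep0 : set0 \in indep;
  indepS : forall I J : {set E}, J \in indep -> I \subset J -> I \in indep;
  indep_augment : forall I J : {set E},
    I \in indep -> J \in indep -> #|I| < #|J| ->
    exists2 x, x \in J :\: I & x |: I \in indep
}.

Section Bingo.

Variables (E : finType) (M : matroid E).

Definition mrank : nat := \max_(I in indep M) #|I|.

Definition circuits : {set {set E}} :=
  [set C | minset (fun A : {set E} => A \notin indep M) C].

(* Orders in which the elements of E can be called out: injective, hence
   bijective, maps from positions to E. Positions are counted from 0, so
   s i is the element called in round i.+1. *)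
Definition orders : {set {ffun 'I_#|E| -> E}} :=
  [set s : {ffun 'I_#|E| -> E} | injectiveb s].

Definition called (s : {ffun 'I_#|E| -> E}) (t : nat) : {set E} :=
  [set s i | i : 'I_#|E| & i < t].

(* The rounds are t.+1 for t : 'I_#|E|. *)
Definition wins_in_round (C : {set E}) (s : {ffun 'I_#|E| -> E})
    (t : 'I_#|E|) : bool :=
  [&& C \in circuits, C \subset called s t.+1
    & [forall D in circuits, ~~ (D \subset called s t)]].

Definition wins (C : {set E}) (s : {ffun 'I_#|E| -> E}) : bool :=
  [exists t, wins_in_round C s t].

(* Probability of winning under the uniform distribution on orders. *)
Definition beta (C : {set E}) : rat :=
  (#|[set s in orders | wins C s]|%:R / #|orders|%:R)%R.

End Bingo.

(* Main.v *)
Require Import Defs.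
From mathcomp Require Import all_boot all_order all_algebra.
From mathcomp Require Import perm.

(* A circuit C1 of size r+1 wins exactly when C1 is the set of the first r+1
   called elements, as no independent set is larger than r. Extending C2 minus
   a point to a basis and adding the point back yields a set A of size r+1
   whose only circuit is C2, so C2 wins whenever A is the set of the first r+1 called elements. A
   permutation of E sending C1 to A therefore maps the orders won by C1
   injectively to orders won by C2. It misses an order that starts with C2
   followed by an element outside A. *)

Import Num.Theory.

(** List [A] before its complement and [B] before its complement, and match the two lists position
    by position. *)
Lemma exists_perm_imset (T : finType) (A B : {set T}) :
  #|A| = #|B| -> exists p : {perm T}, p @: A = B.
Proof.
move=> eqAB; pose l (S : {set T}) := enum S ++ enum (~: S).
have l_uniq S : uniq (l S).
  rewrite cat_uniq !enum_uniq /= andbT; apply/hasPn => x.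
  by rewrite !mem_enum inE.
have mem_l S x : x \in l S by rewrite mem_cat !mem_enum inE orbN.
have size_l S : size (l S) = #|T|.
  by rewrite size_cat -!cardE cardsC.
(* The default [x] is never returned: both lists enumerate all of [T]. *)
pose f x := nth x (l B) (index x (l A)).
have lt_index x : index x (l A) < size (l B).
  by rewrite size_l -(size_l A) index_mem.
have f_inj : injective f.
  move=> x y; rewrite /f (set_nth_default x y) // => /eqP.
  by rewrite nth_uniq // => /eqP /index_inj ->.
exists (perm f_inj); apply/eqP; rewrite eqEcard (card_imset _ perm_inj) eqAB.
rewrite leqnn andbT; apply/subsetP => _ /imsetP[x Ax ->].
have lt_x : index x (enum A) < size (enum B).
  by rewrite -cardE -eqAB cardE index_mem mem_enum.
by rewrite permE /f index_cat mem_enum Ax nth_cat lt_x -mem_enum mem_nth.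
Qed.

Section Matroid.

Context {E : finType} {M : matroid E}.
Implicit Types (A B C D I J : {set E}) (s : {ffun 'I_#|E| -> E}).

(** Augment [I] from [J] one element at a time, by induction on the gap in size. *)
Lemma indep_extend I J :
  I \in indep M -> J \in indep M -> #|I| <= #|J| ->
  exists K, [/\ K \in indep M, I \subset K, K \subset I :|: J & #|K| = #|J|].
Proof.
move=> + indJ; have [k] := ubnP (#|J| - #|I|).
elim: k I => // k IHk I ltk indI; rewrite leq_eqVlt => /predU1P[eqIJ | ltIJ].
  by exists I; rewrite subsetUl.
have [x /setDP[Jx I'x] indxI] := indep_augment indI indJ ltIJ.
have cardxI : #|x |: I| = #|I|.+1 by rewrite cardsU1 I'x.
have [||K [indK sxIK sKxIJ cardK]] := IHk _ _ indxI; rewrite ?cardxI //.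
  by rewrite subnS; case: (#|J| - #|I|) (subn_gt0 #|I| #|J|) ltk => [|m] //;
     rewrite ltIJ.
exists K; split=> //; first exact: subset_trans (subsetUr _ _) sxIK.
apply: subset_trans sKxIJ _.
by rewrite -setUA subUset sub1set inE Jx orbT /=.
Qed.

Lemma circuit_dep C : C \in circuits M -> C \notin indep M.
Proof. by rewrite inE => /minsetp. Qed.

Lemma circuit_sub_eq C D :
  C \in circuits M -> D \in circuits M -> D \subset C -> D = C.
Proof. by rewrite !inE => minC /minsetp depD; apply: (minsetinf minC). Qed.

Lemma circuitD1_indep C x : C \in circuits M -> x \in C -> C :\ x \in indep M.
Proof.
rewrite inE => minC Cx; apply/negPn/negP => /(minsetinf minC).
by move/(_ (subD1set _ _))/setP/(_ x); rewrite !inE eqxx Cx.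
Qed.

Lemma circuit_neq0 C : C \in circuits M -> exists x, x \in C.
Proof.
move=> /circuit_dep depC; apply/set0Pn.
by apply: contraNneq depC => ->; apply: indep0.
Qed.

Lemma indep_no_circuit I :
  [forall D in circuits M, ~~ (D \subset I)] -> I \in indep M.
Proof.
move=> /forall_inP noD; apply/negPn/negP => depI.
have [D minD sDI] := @minset_exists _ (fun A => A \notin indep M) I depI.
have circD : D \in circuits M by rewrite inE.
by case/negP: (noD D circD).
Qed.

Lemma card_indep_mrank I : I \in indep M -> #|I| <= mrank M.
Proof. by move=> indI; apply: (leq_bigmax_cond (F := fun A => #|A|)). Qed.

(** Take [A = e |: K], where [K] extends [C :\ e] to the size of [B]. A circuit in [A] that missed
    some [f] in [C] would lie in [A :\ f]. But extending [C :\ f] inside [A] to the size of [K]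
    fills up [A :\ f], which is thus independent. *)
Lemma unique_circuit_ext C B :
  C \in circuits M -> B \in indep M -> #|C| <= #|B| ->
  exists A, [/\ #|A| = #|B|.+1, C \subset A
    & forall D, D \in circuits M -> D \subset A -> D = C].
Proof.
move=> circC indB leCB; have [e Ce] := circuit_neq0 _ circC.
have leDB x : #|C :\ x| <= #|B|.
  exact: leq_trans (subset_leq_card (subD1set _ _)) leCB.
have [K [indK sCeK _ cardK]] :=
  indep_extend _ _ (circuitD1_indep _ _ circC Ce) indB (leDB e).
have K'e : e \notin K.
  apply: contra (circuit_dep _ circC) => Ke; apply: indepS indK _.
  by rewrite -(setD1K Ce) subUset sub1set Ke.
have sCA : C \subset e |: K by rewrite -(setD1K Ce) setUS.
have cardA : #|e |: K| = #|B|.+1 by rewrite cardsU1 K'e cardK.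
exists (e |: K); split=> // D circD sDA.
apply/esym/circuit_sub_eq => //; apply/subsetP => f Cf; apply/negPn/negP => D'f.
(* It suffices that A minus f is independent, as it contains D. *)
have := leDB f; rewrite -cardK => leCfK.
have [L [indL sCfL sLCK cardL]] :=
  indep_extend _ _ (circuitD1_indep _ _ circC Cf) indK leCfK.
have L'f : f \notin L.
  apply: contra (circuit_dep _ circC) => Lf; apply: indepS indL _.
  by rewrite -(setD1K Cf) subUset sub1set Lf.
have sLA : L \subset (e |: K) :\ f.
  rewrite subsetD1 L'f andbT; apply: subset_trans sLCK _.
  by rewrite subUset subsetUr (subset_trans (subD1set _ _) sCA).
have defL : L = (e |: K) :\ f.
  apply/eqP; rewrite eqEcard sLA /= cardL cardK -ltnS -cardA.
  by rewrite [leqRHS](cardsD1 f) (subsetP sCA).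
case/negP: (circuit_dep _ circD); apply: indepS indL _.
by rewrite defL subsetD1 sDA.
Qed.

Lemma calledS s t u : t <= u -> called s t \subset called s u.
Proof.
move=> letu; apply/subsetP => _ /imsetP[i lt_it ->].
by apply: imset_f; rewrite !inE in lt_it *; apply: leq_trans letu.
Qed.

Lemma card_called s t : s \in orders E -> t <= #|E| -> #|called s t| = t.
Proof.
rewrite inE => /injectiveP s_inj let_n; rewrite card_imset // -sum1_card.
rewrite (eq_bigl (fun i : 'I_#|E| => i < t)) => [|i]; last by rewrite inE.
by rewrite (big_ord_narrow let_n) sum1_card card_ord.
Qed.

Lemma called_comp s (p : {perm E}) t :
  called [ffun i => p (s i)] t = p @: called s t.
Proof.
rewrite /called -imset_comp; apply: eq_imset => i.
by rewrite ffunE.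
Qed.

Lemma comp_orders s (p : {perm E}) :
  s \in orders E -> [ffun i => p (s i)] \in orders E.
Proof.
rewrite !inE => /injectiveP s_inj; apply/injectiveP => i j.
by rewrite !ffunE => /perm_inj/s_inj.
Qed.

(** Call [A] first, then [x], then the rest. *)
Lemma exists_order_called A x : x \notin A ->
  exists2 s, s \in orders E & called s #|A| = A /\ called s #|A|.+1 = x |: A.
Proof.
move=> A'x; pose l := enum A ++ x :: enum (~: (x |: A)).
have l_uniq : uniq l.
  rewrite cat_uniq /= !enum_uniq !mem_enum (negPf A'x) !inE eqxx /= andbT.
  by apply/hasPn => y; rewrite !mem_enum !inE negb_or => /andP[].
have size_l : size l = #|E|.
  rewrite size_cat /= -!cardE addnS -addSn.
  by rewrite -(cardsC (x |: A)) cardsU1 A'x.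
pose s : {ffun 'I_#|E| -> E} := [ffun i : 'I_#|E| => nth x l i].
have s_order : s \in orders E.
  rewrite inE; apply/injectiveP => i j; rewrite !ffunE => /eqP.
  by rewrite nth_uniq ?size_l // => /eqP/val_inj.
have ltA : #|A| < #|E|.
  by rewrite -size_l size_cat /= -cardE addnS ltnS leq_addr.
have sA i : i < #|A| -> nth x l i \in A.
  by rewrite cardE => ltiA; rewrite nth_cat ltiA -mem_enum mem_nth.
exists s => //; split; apply/eqP; rewrite eqEcard card_called ?(ltnW ltA) //.
  rewrite leqnn andbT; apply/subsetP => _ /imsetP[i + ->].
  by rewrite inE ffunE => /sA.
rewrite cardsU1 A'x leqnn andbT; apply/subsetP => _ /imsetP[i + ->].
rewrite inE ltnS leq_eqVlt ffunE => /predU1P[-> | /sA]; last first.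
  by rewrite !inE orbC => ->.
by rewrite nth_cat -cardE ltnn subnn setU11.
Qed.

(** Look at the first time that [C] is complete: a circuit completed earlier would also lie in
    [called s m], hence be [C] itself. *)
Lemma wins_unique_circuit C s m :
  C \in circuits M -> C \subset called s m ->
  (forall D, D \in circuits M -> D \subset called s m -> D = C) ->
  wins M C s.
Proof.
move=> circC sCm uniqC.
have exC : exists t, C \subset called s t by exists m.
case: (ex_minnP exC) => -[|t] sCt mint.
  have [x /(subsetP sCt)/imsetP[i]] := circuit_neq0 _ circC.
  by rewrite inE.
have nCt : ~~ (C \subset called s t) by apply/negP => /mint; rewrite ltnn.
(* [m] is arbitrary, so [t] needs a bound: from time [#|E|] on, the called set no longer grows. *)
have ltt : t < #|E|.
  rewrite ltnNge; apply: contra nCt => let_n.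
  apply: subset_trans sCt _; apply/subsetP => _ /imsetP[i _ ->].
  by apply: imset_f; rewrite inE; apply: leq_trans let_n.
apply/existsP; exists (Ordinal ltt); apply/and3P; split=> //.
apply/forall_inP => D circD; apply: contra nCt => sDt.
rewrite -(uniqC D) //; apply: subset_trans sDt _.
exact: calledS (ltnW (mint _ sCm)).
Qed.

Lemma wins_spanning_circuit C s :
  s \in orders E -> #|C| = (mrank M).+1 -> wins M C s ->
  called s (mrank M).+1 = C.
Proof.
move=> s_order cardC /existsP[t /and3P[_ sCt /indep_no_circuit indt]].
(* The [t] elements called before the winning round are independent, so [t] is at most the rank; the
   [t.+1] elements called by its end contain [C], so [t] is at least the rank. *)
have /eqP eqt : nat_of_ord t == mrank M.
  rewrite eqn_leq -{1}(card_called _ _ s_order (ltnW (ltn_ord t))).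
  rewrite card_indep_mrank //= -ltnS -cardC.
  by rewrite -(card_called _ _ s_order (ltn_ord t)) subset_leq_card.
apply/esym/eqP; rewrite eqEcard -eqt sCt cardC -eqt.
by rewrite (card_called _ _ s_order (ltn_ord t)) /=.
Qed.

End Matroid.

Theorem corollary7 (E : finType) (M : matroid E) (r : nat) (C1 C2 : {set E})
  (rankM : mrank M = r)
  (circuitC1 : C1 \in circuits M) (circuitC2 : C2 \in circuits M)
  (cardC1 : #|C1| = r.+1) (cardC2 : #|C2| < r.+1) :
  (beta M C1 < beta M C2)%R.
Proof.
have [x C1x] := circuit_neq0 _ circuitC1.
have cardB : #|C1 :\ x| = r by move: cardC1; rewrite (cardsD1 x) C1x => -[].
(* [C1 :\ x] is independent of size [r], so it serves as the basis that fixes the size of [A]. *)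
have [|A [cardA sC2A uniqA]] :=
    unique_circuit_ext _ _ circuitC2 (circuitD1_indep _ _ circuitC1 C1x).
  by rewrite cardB.
(* Otherwise [C1] would equal [C2], against their sizes. *)
have /subsetPn[y C1y A'y] : ~~ (C1 \subset A).
  apply: contraL cardC2 => /(uniqA _ circuitC1) <-.
  by rewrite cardC1 ltnn.
have C2'y : y \notin C2 by apply: contra A'y; apply: (subsetP sC2A).
have [p pC1] : exists p : {perm E}, p @: C1 = A.
  by apply: exists_perm_imset; rewrite cardC1 cardA cardB.
have [s0 s0_order [s0C2 s0yC2]] := exists_order_called _ _ C2'y.
pose W C := [set s in orders E | wins M C s].
pose f (s : {ffun 'I_#|E| -> E}) := [ffun i => p (s i)].
have f_inj : injective f.
  move=> s u /ffunP eq_su; apply/ffunP => i.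
  by have := eq_su i; rewrite !ffunE => /perm_inj.
have called_f s : s \in W C1 -> called (f s) r.+1 = A.
  rewrite inE => /andP[s_order].
  rewrite called_comp -rankM => /wins_spanning_circuit -> //.
  by rewrite cardC1 rankM.
have ltW : #|W C1| < #|W C2|.
  rewrite -(card_imset _ f_inj); apply: proper_card; apply/properP; split.
    apply/subsetP => _ /imsetP[s Ws ->]; rewrite inE; apply/andP; split.
      by apply: comp_orders; move: Ws; rewrite inE => /andP[].
    apply: (wins_unique_circuit _ _ r.+1); rewrite ?called_f //.
  exists s0.
    rewrite inE s0_order; apply: (wins_unique_circuit _ _ #|C2|) => //.
      by rewrite s0C2.
    by move=> D circD; rewrite s0C2; apply: circuit_sub_eq circuitC2 circD.
  (* If [s0] were [f s], its first [r.+1] calls would form [A]; yet [y] is among the first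
     [#|C2|.+1] of them. *)
  apply/negP => /imsetP[s Ws def_s0]; case/negP: A'y.
  rewrite -(called_f _ Ws) -def_s0; apply: (subsetP (calledS _ _ _ cardC2)).
  by rewrite s0yC2 setU11.
have orders_gt0 : 0 < #|orders E| by apply/card_gt0P; exists s0.
by rewrite /beta ltr_pM2r ?ltr_nat // invr_gt0 ltr0n.
Qed.
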